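(* Let $n\ge 7$ and let $\mathcal{D}_n=(Q,\Sigma,\delta,0,F)$ be a minimal complete DFA with $n$ states accepting a suffix-free language, with transition semigroup $T(n)$. If $|\Sigma|<5$, then $|T(n)|<(n-1)^{n-2}+n-2$.
   Context: A language $L$ is suffix-free if whenever $w\in L$ and $u\in L$ with $u$ a suffix of $w$, then $u=w$. The transition semigroup of a DFA is the semigroup of transformations of its state set generated by the transformations induced by its letters. *)

(* Defs.v *)
From mathcomp Require Import all_boot.
Set Implicit Arguments. Unset Strict Implicit. Unset Printing Implicit Defensive.

Section DFA.
Variables (n : nat) (Sigma : finType).
Variable delta : Sigma -> 'I_n -> 'I_n.
Variables (s : 'I_n) (F : {set 'I_n}).

Definition run (q : 'I_n) (w : seq Sigma) : 'I_n :=
  foldl (fun p a => delta a p) q w.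

Definition accepts (w : seq Sigma) : bool := run s w \in F.

Definition suffix_free : Prop :=
  forall w u : seq Sigma, accepts w -> accepts u -> suffix u w -> u = w.

Definition minimal : Prop :=
  (forall q : 'I_n, exists w, run s w = q) /\
  (forall p q : 'I_n, (forall w, (run p w \in F) = (run q w \in F)) -> p = q).

Definition induced (w : seq Sigma) : {ffun 'I_n -> 'I_n} :=
  [ffun q => run q w].

Definition in_trans_semigroup (t : {ffun 'I_n -> 'I_n}) : Prop :=
  exists w : seq Sigma, w <> [::] /\ t = induced w.
End DFA.

(* Main.v *)
(** Let e be the empty state, s the initial state and V the m = n - 2 remaining states.
    Suffix-freeness says that the languages of s and of any q in V are disjoint.  Call p, r
    in V colliding if some t in the semigroup T has s t = p and q t = r with q in V; then the
    languages of p and r are disjoint, so no element of T sends p and r to a common state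
    other than e.  Hence every t in T restricts to a partial colouring V -> V + {e}, proper
    for the colliding graph G, and if s t = p is in V this colouring only uses neighbours of
    p.  With Q(k) the number of proper partial k-colourings of G,
      |T| <= Q(m) + sum_p Q(deg p).
    If G has an edge this is less than (m + 1)^m + m.  Indeed, in a uniformly random map to k
    colours and e, the events "colour class c is independent" are negatively correlated
    (Harris), so Q(k) <= (k + 1)^m P^k, where P is the probability that a random set of
    density 1 / (k + 1) is independent; and 1 - P is at least the edge density of G times the
    probability that the set has at least two elements.  Moreover Q(k) is a combination of
    binomials C(k, j), so the part of Q(deg p) coming from colourings with at least two
    colours is at most deg p (deg p - 1) / ((m - 1)(m - 2)) times that of Q(m - 1), and
    de Caen's inequality bounds the sum of the squared degrees.
    If G has no edge, T consists of maps with s t = e, or with s t in V and all of V sent to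
    e; there are (m + 1)^m + m of these, and generating all of them takes two letters
    permuting V, one total non-permutation of V, one partial map and one letter leaving s. *)

From Stdlib Require Import ZArith ClassicalEpsilon.
Require Import Defs.
From mathcomp Require Import all_boot all_order all_fingroup all_algebra.
From mathcomp Require Import zify ring lra.
Set Implicit Arguments. Unset Strict Implicit. Unset Printing Implicit Defensive.

(** * Partial colourings *)

Lemma big_subsetU1 (V : finType) (v : V) (U : {set V}) (F : {set V} -> nat) :
  v \notin U ->
  \sum_(S : {set V} | S \subset v |: U) F S =
    \sum_(S : {set V} | S \subset U) F S + \sum_(S : {set V} | S \subset U) F (v |: S).
Proof.
move=> vU; rewrite (bigID (fun S : {set V} => v \in S)) /= [LHS]addnC; congr (_ + _).
  apply: eq_bigl => S; apply/andP/idP => [[SvU vS]|SU].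
    apply/subsetP => u uS; have := subsetP SvU u uS.
    by rewrite !inE => /orP[/eqP uv|//]; rewrite -uv uS in vS.
  split; first exact: subset_trans SU (subsetUr _ _).
  by apply: contra vU => /(subsetP SU).
rewrite (reindex_onto (fun S => v |: S) (fun S => S :\ v)) /=; last first.
  by move=> S /andP[_ vS]; rewrite setD1K.
apply: eq_bigl => S; rewrite setU11 andbT; apply/andP/idP => [[SvU /eqP E]|SU].
  apply/subsetP => u uS; have := subsetP SvU u (setU1r _ uS).
  by rewrite !inE => /orP[/eqP uv|//]; move: uS; rewrite -E uv !inE eqxx.
split; first by rewrite setUS.
by rewrite setU1K //; apply: contra vU => /(subsetP SU).
Qed.

(* Harris' inequality: S is a random subset of U containing each vertex with
   probability 1 / (x + 1). *)
Lemma harris (V : finType) (x : nat) (U : {set V}) (a b : {set V} -> nat) :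
  (forall S v, a (v |: S) <= a S) -> (forall S v, b S <= b (v |: S)) ->
  x.+1 ^ #|U| * (\sum_(S : {set V} | S \subset U) x ^ (#|U| - #|S|) * (a S * b S)) <=
    (\sum_(S : {set V} | S \subset U) x ^ (#|U| - #|S|) * a S) *
    (\sum_(S : {set V} | S \subset U) x ^ (#|U| - #|S|) * b S).
Proof.
elim: {U}#|U| {-2}U (erefl #|U|) a b => [|k IH] U cU a b adec binc.
  have -> : U = set0 by apply/eqP; rewrite -cards_eq0 cU.
  have E (F : {set V} -> nat) : \sum_(S : {set V} | S \subset set0) F S = F set0.
    by rewrite (big_pred1 set0) // => S; rewrite subset0.
  by rewrite !E cards0 !mul1n.
have [v vU] : exists v, v \in U by apply/card_gt0P; rewrite cU.
set W := U :\ v; have cW : #|W| = k by move: cU; rewrite (cardsD1 v U) vU => -[].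
have vW : v \notin W by rewrite !inE eqxx.
have split (c : {set V} -> nat) :
    \sum_(S : {set V} | S \subset U) x ^ (k.+1 - #|S|) * c S =
    x * (\sum_(S : {set V} | S \subset W) x ^ (k - #|S|) * c S) +
    \sum_(S : {set V} | S \subset W) x ^ (k - #|S|) * c (v |: S).
  rewrite -(setD1K vU) (@big_subsetU1 _ v W) //; congr (_ + _).
    rewrite big_distrr /=; apply: eq_bigr => S SW.
    by rewrite subSn -?cW ?subset_leq_card // expnS mulnA.
  apply: eq_bigr => S SW; rewrite cardsU1.
  by have -> : v \notin S by apply: contra vW => /(subsetP SW).
rewrite cU (split (fun S => a S * b S)) !split /=.
have adec1 S u : a (v |: (u |: S)) <= a (v |: S) by rewrite setUCA adec.
have binc1 S u : b (v |: S) <= b (v |: (u |: S)) by rewrite setUCA binc.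
have := IH W cW a b adec binc.
have := IH W cW (fun S => a (v |: S)) (fun S => b (v |: S)) adec1 binc1.
rewrite !cW.
set a0 := \sum_(S : {set V} | _) _ * a S; set b0 := \sum_(S : {set V} | _) _ * b S.
set a1 := \sum_(S : {set V} | _) _ * a (v |: S).
set b1 := \sum_(S : {set V} | _) _ * b (v |: S).
set c0 := \sum_(S : {set V} | _) _ * (a S * b S).
set c1 := \sum_(S : {set V} | _) _ * (a (v |: S) * _).
have a10 : a1 <= a0 by apply: leq_sum => S _; rewrite leq_mul2l adec orbT.
have b01 : b0 <= b1 by apply: leq_sum => S _; rewrite leq_mul2l binc orbT.
rewrite expnS; set N := _ ^ k => h1 h0.
have h : N * (x * c0 + c1) <= x * (a0 * b0) + a1 * b1 by nia.
apply: leq_trans (_ : x.+1 * (x * (a0 * b0) + a1 * b1) <= _).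
  by rewrite -mulnA leq_mul2l h orbT.
(* The right side exceeds the left by exactly [x * u * w]. *)
rewrite -(subnKC a10) -(subnKC b01); set u := a0 - a1; set w := b1 - b0.
nia.
Qed.

Section Colourings.
Variables (V : finType) (g : rel V).

Definition indep (S : {set V}) := [forall a in S, forall b in S, ~~ g a b].

Lemma indepS (S W : {set V}) : S \subset W -> indep W -> indep S.
Proof.
move=> SW /forall_inP h; apply/forall_inP => a aS; apply/forall_inP => b bS.
by have /forall_inP := h a (subsetP SW _ aS); apply; apply: (subsetP SW).
Qed.

(* Number of maps from U to j + l values for which the fibres of the first j
   values are independent. *)
Fixpoint ncol (j l : nat) (U : {set V}) : nat :=
  if j is j'.+1 then
    \sum_(S : {set V} | (S \subset U) && indep S) ncol j' l (U :\: S)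
  else l ^ #|U|.

Lemma ncolS j l U : ncol j.+1 l U =
  \sum_(S : {set V} | S \subset U) indep S * ncol j l (U :\: S).
Proof.
rewrite /= big_mkcondr; apply: eq_bigr => S _.
by case: (indep S); rewrite ?mul1n.
Qed.

(** A colouring of [v |: U] is determined by its restriction to [U] and its value at [v], one of
    [j + l]. *)
Lemma leq_ncolU1 j l v (U : {set V}) :
  v \notin U -> ncol j l (v |: U) <= (j + l) * ncol j l U.
Proof.
elim: j U => [|j IH] U vU; first by rewrite /= cardsU1 vU expnS.
rewrite !ncolS big_subsetU1 // addSn mulSn addnC; apply: leq_add.
  apply: leq_sum => S SU; apply: leq_mul.
    case: (boolP (indep (v |: S))) => // h; rewrite (indepS _ h) //.
    exact: subsetUr.
  have -> // : (v |: U) :\: (v |: S) = U :\: S.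
  apply/setP => u; rewrite !inE; case: eqP => //= ->.
  by rewrite (negbTE vU) andbF.
rewrite big_distrr; apply: leq_sum => S SU /=.
rewrite mulnCA leq_mul2l; apply/orP; right.
have -> : (v |: U) :\: S = v |: (U :\: S).
  apply/setP => u; rewrite !inE; case: eqP => //= ->.
  by rewrite (contra (subsetP SU v)).
by apply: IH; rewrite !inE (negbTE vU) andbF.
Qed.

Lemma sum_expn_subsets x (U : {set V}) :
  \sum_(S : {set V} | S \subset U) x ^ #|U :\: S| = x.+1 ^ #|U|.
Proof.
elim: {U}#|U| {-2}U (erefl #|U|) => [|k IH] U cU.
  have -> : U = set0 by apply/eqP; rewrite -cards_eq0 cU.
  rewrite (big_pred1 set0) => [|S]; last by rewrite subset0.
  by rewrite set0D cards0.
have [v vU] : exists v, v \in U by apply/card_gt0P; rewrite cU.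
have cW : #|U :\ v| = k by move: cU; rewrite (cardsD1 v U) vU => -[].
rewrite cU expnS -{1}cW -(IH _ cW) mulSn addnC.
have := @big_subsetU1 V v (U :\ v) (fun S => x ^ #|U :\: S|).
rewrite setD1K // => -> ; last by rewrite setD11.
congr (_ + _); last first.
  apply: eq_bigr => S SU; congr (x ^ #|pred_of_set _|).
  by apply/setP => u; rewrite !inE negb_or -andbA; case: eqP; rewrite /= ?andbF.
rewrite big_distrr; apply: eq_bigr => S SU /=; rewrite -expnS; congr (x ^ _).
have vS : v \notin S by apply/negP => /(subsetP SU); rewrite !inE eqxx.
rewrite (cardsD1 v) !inE vS vU add1n; congr #|pred_of_set _|.+1.
by apply/setP => u; rewrite !inE; case: eqP; rewrite /= ?andbF.
Qed.

(** Both sides count the same maps; the right one sorts them by the fibre [S] of one unrestricted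
    value. *)
Lemma ncol_free j l (U : {set V}) :
  ncol j l.+1 U = \sum_(S : {set V} | S \subset U) ncol j l (U :\: S).
Proof.
elim: j U => [|j IH] U; first by rewrite /= sum_expn_subsets.
rewrite ncolS.
under eq_bigr => S _ do rewrite IH big_distrr /=.
under [RHS]eq_bigr => S _ do rewrite ncolS.
rewrite [LHS](exchange_big_dep (fun X : {set V} => X \subset U)) /=; last first.
  by move=> S S' _ h; apply: subset_trans h (subsetDl _ _).
apply: eq_bigr => S' S'U; apply: eq_big => [S|S _].
  by rewrite !subsetD S'U /= disjoint_sym.
by rewrite !setDDl setUC.
Qed.

(** This is [x.+1 ^ #|V|] times the probability that a random set of density [1 / (x + 1)] is
    independent. *)
Definition indep_weight x := \sum_(S : {set V} | indep S) x ^ (#|V| - #|S|).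

(** Requiring one more fibre to be independent is a decreasing event in that fibre, so [harris]
    bounds its effect on the count by the factor for a random set. *)
Lemma ncol_harris j l : 0 < j + l ->
  (j + l).+1 ^ #|V| * ncol j.+1 l setT <=
    indep_weight (j + l) * ncol j l.+1 setT.
Proof.
set x := j + l => x0.
have adec S v : (indep (v |: S) : nat) <= indep S.
  case: (boolP (indep (v |: S))) => // hS.
  by rewrite (indepS _ hS) // subsetUr.
(* Adding [v] to the fibre divides the number of completions by at most [x]; the factor [x ^ #|S|]
   makes up for this and also cancels the weight in [harris], leaving plain counts. *)
have binc (S : {set V}) v : x ^ #|S| * ncol j l (~: S) <= x ^ #|v |: S| * ncol j l (~: (v |: S)).
  case: (boolP (v \in S)) => vS; first by rewrite (setUidPr _) // sub1set.
  rewrite cardsU1 vS expnSr -mulnA leq_mul2l; apply/orP; right.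
  have -> : ~: S = v |: ~: (v |: S).
    by apply/setP => u; rewrite !inE; case: eqP => //= ->; rewrite vS.
  by apply: leq_ncolU1; rewrite !inE eqxx.
have := harris x setT adec binc; rewrite cardsT.
have pos : 0 < x ^ #|V| by rewrite expn_gt0 x0.
have e1 (F : {set V} -> nat) :
   \sum_(S : {set V} | S \subset setT)
     x ^ (#|V| - #|S|) * (F S * (x ^ #|S| * ncol j l (~: S)))
   = x ^ #|V| * \sum_(S : {set V} | S \subset setT) F S * ncol j l (setT :\: S).
  rewrite big_distrr; apply: eq_bigr => S _ /=.
  by rewrite -setTD mulnCA [x ^ (_ - _) * _]mulnA -expnD subnK ?max_card // mulnCA.
rewrite e1 -ncolS.
have -> : \sum_(S : {set V} | S \subset setT) x ^ (#|V| - #|S|) * indep S = indep_weight x.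
  rewrite /indep_weight [RHS]big_mkcond; apply: eq_big => S; first by rewrite subsetT.
  by case: (indep S); rewrite ?muln1 ?muln0.
have := e1 (fun=> 1).
under eq_bigr => S _ do rewrite mul1n.
under [X in _ = _ * X]eq_bigr => S _ do rewrite mul1n.
rewrite -ncol_free => ->.
by rewrite mulnCA (mulnCA (indep_weight _)) leq_pmul2l.
Qed.

(** Starting from [k + 1] free values, [ncol_harris] makes all but one of them independent, one at a
    time. *)
Lemma ncol_upper k : 0 < k ->
  ncol k 1 setT * (k.+1 ^ #|V|) ^ k <= indep_weight k ^ k * k.+1 ^ #|V|.
Proof.
move=> k0.
have H j l : j + l = k.+1 -> 0 < l ->
    ncol j l setT * (k.+1 ^ #|V|) ^ j <= indep_weight k ^ j * k.+1 ^ #|V|.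
  elim: j l => [|j IH] l; first by rewrite add0n => -> _; rewrite /= cardsT muln1 mul1n.
  rewrite addSn => -[jl] l0; have := @ncol_harris j l; rewrite jl => /(_ k0) h.
  have := IH l.+1; rewrite addnS jl => /(_ erefl isT) h'.
  rewrite !expnS mulnA (mulnC (ncol _ _ _)).
  apply: leq_trans (leq_mul h (leqnn _)) _.
  by rewrite -mulnA -mulnA leq_mul2l h' orbT.
by apply: H; rewrite ?addn1.
Qed.

(** Counts ordered [j]-tuples of disjoint non-empty independent subsets of [U]. What they leave over
    is uncoloured, hence the value 1 at [j = 0]. *)
Fixpoint nsurj (j : nat) (U : {set V}) : nat :=
  if j is j'.+1 then
    \sum_(S : {set V} | [&& S \subset U, indep S & S != set0]) nsurj j' (U :\: S)
  else 1.

Lemma indep0 : indep set0.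
Proof. by apply/forall_inP => a; rewrite inE. Qed.

(** Colourings are sorted by the set of colours in use. Pascal's rule reflects whether the first
    colour occurs; terms with [j > k] vanish, so any [n >= k] may end the sum. *)
Lemma ncol_nsurj k n (U : {set V}) : k <= n ->
  ncol k 1 U = \sum_(0 <= j < n.+1) 'C(k, j) * nsurj j U.
Proof.
elim: k n U => [|k IH] n U kn.
  rewrite big_nat_recl //= big1 ?exp1n //.
rewrite /= (bigD1 set0) /=; last by rewrite sub0set indep0.
rewrite setD0 (IH n) ?(ltnW kn) //.
case: n kn => // n kn.
under [X in _ + X]eq_bigr => S _ do rewrite (IH n) //.
rewrite exchange_big /= big_nat_recl // [RHS]big_nat_recl // -addnA; congr (_ + _).
  by rewrite !bin0.
rewrite -big_split /=; apply: eq_bigr => j _.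
rewrite binS mulnDl; congr (_ + _); rewrite big_distrr /=.
by apply: eq_bigl => S; rewrite -andbA.
Qed.

Lemma nsurj1 U : nsurj 1 U <= 2 ^ #|V|.
Proof.
rewrite /= sum1_card; apply: leq_trans (max_card _) _.
by rewrite -(cardsT V) -card_powerset powersetT cardsT.
Qed.

(** [None] is the blank value, the only one that adjacent vertices may share. *)
Definition colourings (C : finType) (D : {set C}) (U : {set V}) :=
  [set f : {ffun V -> option C} |
    [forall a, forall b, g a b ==> (f a == f b) ==> (f a == None)] &&
    [forall a, if f a is Some c then (c \in D) && (a \in U) else true]].

Lemma card_colourings (C : finType) (D : {set C}) (U : {set V}) :
  #|colourings D U| <= ncol #|D| 1 U.
Proof.
elim: {D}#|D| {-2}D (erefl #|D|) U => [|k IH] D cD U.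
  rewrite cD /= exp1n; have {cD} -> : D = set0 by apply/eqP; rewrite -cards_eq0 cD.
  apply/card_le1_eqP => f h; rewrite !inE => /andP[_ /forallP hf] /andP[_ /forallP hh].
  apply/ffunP => a; move: (hf a) (hh a).
  by case: (f a) => [c|]; case: (h a) => [c'|]; rewrite ?inE.
have [c cD'] : exists c, c \in D by apply/card_gt0P; rewrite cD.
have cE : #|D :\ c| = k by move: cD; rewrite (cardsD1 c D) cD' => -[].
pose pre (f : {ffun V -> option C}) := [set a | f a == Some c].
have preP f : f \in colourings D U -> (pre f \subset U) && indep (pre f).
  rewrite inE => /andP[/forallP h1 /forallP h2]; apply/andP; split.
    by apply/subsetP => a; rewrite inE => /eqP fa; have := h2 a; rewrite fa => /andP[].
  apply/forall_inP => a; rewrite inE => /eqP fa.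
  apply/forall_inP => b; rewrite inE => /eqP fb.
  by apply/negP => gab; have /forallP/(_ b) := h1 a; rewrite gab fa fb eqxx.
rewrite cD -sum1_card (partition_big pre (fun S => (S \subset U) && indep S)) //=.
apply: leq_sum => S _; rewrite -cE; apply: leq_trans (IH _ cE _); rewrite sum1dep_card.
(* Once the class [S] of [c] is given, erasing [c] loses no information. *)
pose er (f : {ffun V -> option C}) := [ffun a => if f a == Some c then None else f a].
rewrite -(card_in_imset (f := er)) => [|f h]; last first.
  rewrite !inE => /andP[_ /eqP fS] /andP[_ /eqP hS] /ffunP e; apply/ffunP => a.
  have := e a; rewrite !ffunE.
  have : (a \in pre f) = (a \in pre h) by rewrite fS hS.
  by rewrite !inE; case: eqP => [->|_]; case: eqP.
apply: subset_leq_card; apply/subsetP => _ /imsetP[f + ->].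
rewrite !inE => /andP[/andP[/forallP h1 /forallP h2] /eqP fS].
apply/andP; split.
  apply/forallP => a; apply/forallP => b; apply/implyP => gab; apply/implyP.
  have /forallP/(_ b) := h1 a; rewrite gab !ffunE /=.
  case: ifP => [//|_]; case: ifP => [_ _ //|_ /implyP]; exact.
apply/forallP => a; rewrite ffunE; have := h2 a.
case: ifP => //; case fa: (f a) => [c'|] // ne /andP[c'D aU].
rewrite !inE c'D aU -fS inE fa ne /= !andbT.
by apply/eqP => cc; rewrite cc eqxx in ne.
Qed.
End Colourings.

(** * Degrees and independent sets *)

Lemma bin_falling2 n j : 'C(n, j.+2) * (j.+2 * j.+1) = n * n.-1 * 'C(n.-2, j).
Proof.
have h1 := mul_bin_diag n j.+1; have h2 := mul_bin_diag n.-1 j.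
by rewrite mulnC mulnAC -h1 -mulnA (mulnC _ j.+1) -h2 mulnA.
Qed.

(** With [y = M - d], the bound [d * d + R] on [S] suffices if [y <= d]; otherwise it is taken [d]
    times and the bound [d * M] is taken [y - d] times. *)
Lemma de_caen_arith d S R M : d <= M -> S <= d * M -> S <= d * d + R ->
  M * (d * d + S) + d * M <= d * (d + S + R + M * M).
Proof.
move=> /subnKC <-; set y := M - d => h1 h2.
suff : y * S + d * y <= d * R + d * d * y + d * (y * y) by nia.
case: (leqP y d) => yd; first by nia.
have : d * S + (y - d) * S <= d * (d * d + R) + (y - d) * (d * (d + y)).
  by apply: leq_add; rewrite leq_mul2l ?h1 ?h2 orbT.
rewrite -(subnKC (ltnW yd)); set z := y - d.
by case: (d) => [|d']; nia.
Qed.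

Section Graph.
Variables (V : finType) (g : rel V).
Hypotheses (gsym : symmetric g) (girr : irreflexive g).

Definition deg v := #|[set u | g v u]|.
Definition arcs := \sum_v deg v.

Lemma deg_le v : deg v <= #|V|.-1.
Proof.
rewrite -(cardsC1 v); apply: subset_leq_card; apply/subsetP => u.
by rewrite !inE; apply: contraTneq => ->; rewrite girr.
Qed.

Lemma degE v : deg v = \sum_u g v u.
Proof.
rewrite /deg -sum1_card big_mkcond; apply: eq_bigr => u _.
by rewrite inE; case: (g v u).
Qed.

(** Of the [S] arcs leaving neighbours of [v], [deg v] return to [v], at most [deg v * (deg v - 1)]
    stay among the neighbours, and by symmetry at most [R] go elsewhere. *)
Lemma de_caen_local v :
  #|V|.-1 * (deg v * deg v + \sum_(u | g v u) deg u) + deg v * #|V|.-1 <=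
    deg v * (arcs + #|V|.-1 * #|V|.-1).
Proof.
set S := \sum_(u | g v u) deg u.
set R := \sum_(u | (u != v) && ~~ g v u) deg u.
have split (F : V -> nat) : \sum_u F u =
    F v + \sum_(u | g v u) F u + \sum_(u | (u != v) && ~~ g v u) F u.
  rewrite (bigD1 v) //= (bigID (g v)) /= addnA; congr (_ + _ + _).
  by apply: eq_bigl => u; case: eqP => // ->; rewrite girr.
rewrite /arcs split -/S -/R; apply: de_caen_arith (deg_le v) _ _.
  apply: (@leq_trans (\sum_(u | g v u) #|V|.-1)); last by rewrite sum_nat_const /deg cardsE.
  by apply: leq_sum => u _; apply: deg_le.
rewrite /S; under eq_bigr => u _ do rewrite degE.
rewrite exchange_big /= split; apply: leq_add.
  have -> : \sum_(i | g v i) g i v = deg v.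
    rewrite /deg -sum1_card; apply: eq_big => u; rewrite ?inE // => h.
    by rewrite gsym h.
  have dd : deg v + deg v * (deg v).-1 = deg v * deg v by case: (deg v) => // d; rewrite /= mulnS.
  rewrite -dd leq_add2l {1}/deg -sum1_card big_distrl /=.
  under [X in _ <= X]eq_bigl => u do rewrite inE.
  apply: leq_sum => w gvw; rewrite mul1n.
  rewrite (bigD1 w) //= girr add0n -ltnS prednK; last by apply/card_gt0P; exists w; rewrite inE.
  rewrite /deg (cardsD1 w) inE gvw add1n ltnS -sum1_card big_mkcond [X in _ <= X]big_mkcond.
  by apply: leq_sum => u _; rewrite !inE andbC; case: ifP => // _; case: (g u w).
apply: leq_sum => w _; rewrite degE big_mkcond; apply: leq_sum => u _.
by rewrite (gsym w); case: ifP.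
Qed.

(** Sum of [de_caen_local] over [v]. With [M = #|V| - 1] and [e] arcs, this is de Caen's bound
    [e / 2 * (e / M + M - 1)] on the sum of squared degrees. *)
Lemma de_caen :
  2 * #|V|.-1 * (\sum_v deg v * (deg v).-1) + 3 * #|V|.-1 * arcs <=
    arcs * (arcs + #|V|.-1 * #|V|.-1).
Proof.
have : \sum_v (#|V|.-1 * (deg v * deg v + \sum_(u | g v u) deg u) + deg v * #|V|.-1) <=
    \sum_v deg v * (arcs + #|V|.-1 * #|V|.-1).
  by apply: leq_sum => v _; apply: de_caen_local.
rewrite -[X in _ <= X -> _]big_distrl big_split /= -big_distrr -big_distrl big_split /= -/arcs.
have -> : \sum_v \sum_(u | g v u) deg u = \sum_v deg v * deg v.
  rewrite (exchange_big_dep predT) //=; apply: eq_bigr => u _.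
  rewrite sum_nat_const; congr (_ * _); rewrite /deg.
  by apply: eq_card => w; rewrite !inE gsym.
have -> : \sum_v deg v * deg v = \sum_v deg v * (deg v).-1 + arcs.
  by rewrite /arcs -big_split; apply: eq_bigr => v _ /=; case: (deg v) => // d /=; rewrite -mulnSr.
rewrite -/arcs; set s := \sum_v _; set M := _.-1; move: s M arcs => s M e; nia.
Qed.

Lemma card_draws_pair (a b : V) j : a != b ->
  'C(#|V|.-2, j) <= #|[set S : {set V} | [&& #|S| == j.+2, a \in S & b \in S]]|.
Proof.
move=> ab; set B := ~: [set a; b].
have cB : #|B| = #|V|.-2 by rewrite -(cardsC [set a; b]) cards2 ab.
rewrite -cB -cards_draws.
rewrite -(card_in_imset (f := fun A => a |: (b |: A))) => [|A A'].
  apply: subset_leq_card; apply/subsetP => _ /imsetP[A + ->].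
  rewrite !inE => /andP[AB /eqP cA].
  have aA : a \notin A by apply/negP => /(subsetP AB); rewrite !inE eqxx.
  have bA : b \notin A by apply/negP => /(subsetP AB); rewrite !inE eqxx orbT.
  by rewrite !cardsU1 !inE !eqxx (negbTE aA) (negbTE bA) (negbTE ab) cA /= orbT !add1n eqxx.
have K (X : {set V}) : X \subset B -> (a |: (b |: X)) :&: B = X.
  move=> XB; apply/setP => u; rewrite !inE.
  case: (boolP (u \in X)) => uX.
    by have := subsetP XB u uX; rewrite !inE => ->; rewrite !orbT.
  by case: eqP => //=; case: eqP.
by rewrite !inE => /andP[AB _] /andP[A'B _] e; rewrite -(K A) // e K.
Qed.

(** Each arc lies in ['C(#|V| - 2, j)] sets of size [j + 2], and each such set contains at most
    [(j + 2) * (j + 1)] arcs. So the proportion of dependent sets is at least the edge density. *)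
Lemma card_indep_draws j :
  #|[set S : {set V} | (#|S| == j.+2) && indep g S]| * (#|V| * #|V|.-1) + arcs * 'C(#|V|, j.+2)
    <= 'C(#|V|, j.+2) * (#|V| * #|V|.-1).
Proof.
set Ind := [set S : {set V} | _ && indep g S].
set NI := [set S : {set V} | (#|S| == j.+2) && ~~ indep g S].
have cC : #|Ind| + #|NI| = 'C(#|V|, j.+2).
  rewrite -card_draws -(cardsID [set S | indep g S] [set A : {set V} | #|A| == j.+2]).
  by congr (_ + _); apply: eq_card => S; rewrite !inE // andbC.
suff h : arcs * 'C(#|V|, j.+2) <= #|NI| * (#|V| * #|V|.-1) by rewrite -{2}cC mulnDl leq_add2l.
suff h : arcs * 'C(#|V|.-2, j) <= #|NI| * (j.+2 * j.+1).
  rewrite -(@leq_pmul2r (j.+2 * j.+1)) // -mulnA bin_falling2.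
  have : #|V| * #|V|.-1 * (arcs * 'C(#|V|.-2, j)) <= #|V| * #|V|.-1 * (#|NI| * (j.+2 * j.+1)).
    by rewrite leq_mul2l h orbT.
  by move: arcs #|NI| 'C(#|V|.-2, j) #|V|.-1 #|V| => ? ? ? ? ?; lia.
have h1 : arcs * 'C(#|V|.-2, j) <=
    \sum_a \sum_(b | g a b) \sum_(S : {set V} | #|S| == j.+2) (a \in S) && (b \in S).
  rewrite /arcs big_distrl; apply: leq_sum => a _ /=.
  rewrite degE big_distrl [X in _ <= X]big_mkcond; apply: leq_sum => b _ /=.
  case: ifP => // gab; rewrite mul1n.
  have ab : a != b by apply/eqP => ab; rewrite ab girr in gab.
  apply: leq_trans (card_draws_pair j ab) _; rewrite -sum1_card big_mkcond [X in _ <= X]big_mkcond.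
  by apply: leq_sum => S _; rewrite inE; case: eqP => //= _; case: (_ && _).
apply: leq_trans h1 _.
under eq_bigr => a _ do rewrite exchange_big /=.
rewrite exchange_big /= -sum1_card big_distrl /= [X in _ <= X]big_mkcond [X in X <= _]big_mkcond.
apply: leq_sum => S _; rewrite inE; case: eqP => //= cS; case: (boolP (indep g S)) => /= iS.
  rewrite big1 // => a _; rewrite big1 // => b gab; apply/eqP; rewrite eqb0.
  apply/negP => /andP[aS bS]; have /forall_inP/(_ a aS)/forall_inP/(_ b bS) := iS.
  by rewrite gab.
rewrite mul1n -{1}cS -sum1_card big_distrl [X in _ <= X]big_mkcond /=; apply: leq_sum => a _.
case: (boolP (a \in S)) => aS /=; last by rewrite big1.
rewrite mul1n; have -> : j.+1 = #|S :\ a| by move: cS; rewrite (cardsD1 a) aS => -[].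
rewrite -sum1_card big_mkcond [X in _ <= X]big_mkcond; apply: leq_sum => b _; rewrite !inE.
case: ifP => // gab; have -> : b != a by apply/eqP => ab; rewrite ab girr in gab.
by case: (b \in S).
Qed.

(** [b] is the total weight of the sets with at least two elements. Smaller sets are counted in
    full; from each larger size [card_indep_draws] removes a proportion given by the edge
    density. *)
Lemma indep_weight_upper x b : 1 < #|V| ->
  x.+1 ^ #|V| = x ^ #|V| + #|V| * x ^ #|V|.-1 + b ->
  indep_weight g x * (#|V| * #|V|.-1) + arcs * b <= x.+1 ^ #|V| * (#|V| * #|V|.-1).
Proof.
set m := #|V| => m1.
pose ind j := #|[set S : {set V} | (#|S| == j) && indep g S]|.
have EI : indep_weight g x = \sum_(0 <= j < m.+1) x ^ (m - j) * ind j.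
  rewrite big_mkord /indep_weight.
  rewrite (partition_big (fun S : {set V} => inord #|S| : 'I_m.+1) predT) //=.
  apply: eq_bigr => j _; rewrite mulnC -sum_nat_const.
  apply: eq_big => [S|S /andP[_ /eqP <-]].
    rewrite inE andbC -val_eqE /= inordK // ltnS; exact: max_card.
  by rewrite inordK // ltnS; exact: max_card.
have EX : x.+1 ^ m = \sum_(0 <= j < m.+1) x ^ (m - j) * 'C(m, j).
  rewrite -addn1 expnDn big_mkord; apply: eq_bigr => j _.
  by rewrite exp1n muln1 mulnC.
have ind_le j : ind j <= 'C(m, j).
  rewrite -card_draws; apply: subset_leq_card; apply/subsetP => S.
  by rewrite !inE => /andP[].
have s2 F : \sum_(0 <= j < m.+1) F j = F 0 + F 1 + \sum_(2 <= j < m.+1) F j.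
  by rewrite [LHS]big_ltn // [X in _ + X = _]big_ltn ?addnA ?ltnS ?(ltnW m1).
move=> Eb; have {}Eb : b = \sum_(2 <= j < m.+1) x ^ (m - j) * 'C(m, j).
  apply: (@addnI (x ^ m + m * x ^ m.-1)); rewrite -Eb EX.
  by rewrite s2 subn0 bin0 muln1 bin1 subn1 (mulnC m).
rewrite EI EX !s2 Eb [X in X + _ <= _]mulnDl [X in _ <= X]mulnDl -addnA; apply: leq_add.
  by rewrite leq_mul2r; apply/orP; right; apply: leq_add; rewrite leq_mul2l ind_le orbT.
rewrite big_distrl big_distrr -big_split /= big_distrl /=.
rewrite big_nat_cond [X in _ <= X]big_nat_cond.
apply: leq_sum => -[|[|j]] // _.
by rewrite -mulnA (mulnCA arcs) -mulnDr -mulnA leq_mul2l card_indep_draws orbT.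
Qed.

(** Counts the partial [k]-colourings with at least two colours in use; the range of [j] is complete
    for [k < #|V|]. *)
Definition ncol_ge2 k := \sum_(2 <= j < #|V|) 'C(k, j) * nsurj g j setT.

Lemma ncol_split k : 2 < #|V| -> k < #|V| ->
  ncol g k 1 setT = 1 + k * nsurj g 1 setT + ncol_ge2 k.
Proof.
move=> V2 kV; rewrite (@ncol_nsurj _ _ k #|V|.-1); last by rewrite -ltnS prednK // (leq_trans _ kV).
rewrite prednK ?(leq_trans _ kV) // big_ltn ?(leq_trans _ V2) // big_ltn ?(ltnW V2) //.
by rewrite bin0 bin1 mul1n addnA.
Qed.

(** For [j >= 2] the ratio of ['C(d, j)] to ['C(K, j)] is at most its value at [j = 2]. *)
Lemma ncol_ge2_scale d K : d <= K -> ncol_ge2 d * (K * K.-1) <= d * d.-1 * ncol_ge2 K.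
Proof.
move=> dK; rewrite /ncol_ge2 big_distrl big_distrr /=.
rewrite big_nat_cond [X in _ <= X]big_nat_cond.
apply: leq_sum => -[|[|j]] // _.
rewrite [X in X <= _]mulnAC [X in _ <= X]mulnA leq_mul2r; apply/orP; right.
rewrite -(@leq_pmul2r (j.+2 * j.+1)) //.
have h1 := bin_falling2 d j; have h2 := bin_falling2 K j.
have h3 : 'C(d.-2, j) <= 'C(K.-2, j) by apply: leq_bin2l; lia.
have h : d * d.-1 * (K * K.-1) * 'C(d.-2, j) <= d * d.-1 * (K * K.-1) * 'C(K.-2, j).
  by rewrite leq_mul2l h3 orbT.
have -> : 'C(d, j.+2) * (K * K.-1) * (j.+2 * j.+1) = d * d.-1 * (K * K.-1) * 'C(d.-2, j).
  by rewrite mulnAC h1 mulnAC.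
by rewrite -[X in _ <= X]mulnA h2 [X in _ <= X]mulnA.
Qed.
End Graph.

(** * The numerical inequality *)

Local Delimit Scope Z_scope with BZ.

(** * Orders five to eight, by exact computation *)

Section SmallOrder.
Local Open Scope Z_scope.

(* The inequality of [combine_bounds] for the bounds on [Q(m)], [Q(m - 1)] and the degree sum,
   with denominators cleared; [e] is twice the number of edges. *)
Definition small_check (m e : Z) : bool :=
  let K := m - 1 in let B := m * K in
  let N := (m + 1) ^ m in let M := m ^ m in
  let A1 := (B * N - e * (N - 2 * M)) ^ m in
  let A2 := (B * M - e * (M - K ^ m - m * K ^ K)) ^ K in
  let P1 := (B * N) ^ m in let P2 := (B * M) ^ K in
  let H := 2 * K * K * (K - 1) in let An := e * (e + K * K - 3 * K) in
  (An * K <=? e * H) &&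
  (H * N * A1 * P2 + An * M * A2 * P1 + (e * H - An * K) * 2 ^ m * (P1 * P2)
     <? H * N * (P1 * P2)).

Lemma small_checkP :
  all (fun m => all (fun e => small_check (Z.of_nat m) (Z.of_nat e)) (iota 1 (m * m.-1)))
    (iota 5 4).
Proof. by vm_compute. Qed.

Lemma Z_of_expn (a b : nat) : Z.of_nat (expn a b) = Z.of_nat a ^ Z.of_nat b.
Proof.
elim: b => [|b IH]; first by rewrite expn0.
rewrite expnS Nat2Z.inj_succ Z.pow_succ_r; lia.
Qed.

(** Bounding [Y] through [QK - 1 - K * sg] gives [sg] the total coefficient [e - An * K / H]. This
    is non-negative by hypothesis, so [sg] may be replaced by [T]. *)
Lemma combine_bounds Qm QK Y sg T e K N M A1 A2 P1 P2 H An :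
  0 < P1 -> 0 < P2 -> 0 < H -> 0 <= An ->
  Qm * P1 <= N * A1 -> QK * P2 <= M * A2 -> Y * H <= An * (QK - 1 - K * sg) ->
  sg <= T -> An * K <= e * H ->
  H * N * A1 * P2 + An * M * A2 * P1 + (e * H - An * K) * T * (P1 * P2) < H * N * (P1 * P2) ->
  Qm + e * sg + Y < N.
Proof.
move=> P1p P2p Hp An0 h1 h2 h3 h4 h5 h6.
have g1 := Z.mul_le_mono_nonneg_l _ _ (H * P2) ltac:(lia) h1.
have g2 := Z.mul_le_mono_nonneg_l _ _ (An * P1) ltac:(lia) h2.
have g3 := Z.mul_le_mono_nonneg_l _ _ (P1 * P2) ltac:(lia) h3.
have g4 : (e * H - An * K) * (P1 * P2) * sg <= (e * H - An * K) * (P1 * P2) * T.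
  by apply: Z.mul_le_mono_nonneg_l => //; apply: Z.mul_nonneg_nonneg; lia.
have g5 : 0 <= An * (P1 * P2) by apply: Z.mul_nonneg_nonneg; lia.
apply: (proj2 (Z.mul_lt_mono_pos_r (H * (P1 * P2)) _ _ _)); last by lia.
by apply: Z.mul_pos_pos => //; apply: Z.mul_pos_pos.
Qed.

End SmallOrder.

Section Numeric.
Local Open Scope nat_scope.

(** Combines [Q / P <= (I / P) ^ k] with [I / P <= 1 - t / (B * P)], free of division. *)
Lemma scale_bound Q P I k B t : 0 < k ->
  Q * P ^ k <= I ^ k * P -> I * B + t <= P * B ->
  Q * (B * P) ^ k <= P * (B * P - t) ^ k.
Proof.
move=> k0 h hI; rewrite expnMn mulnCA; apply: leq_trans (leq_mul (leqnn _) h) _.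
rewrite mulnA -expnMn mulnC leq_mul2l leq_exp2r //; apply/orP; right.
by clear -hI; lia.
Qed.

(* [m] is the number of vertices, [e] twice the number of edges, [Qm] and [QK] the numbers of
   partial colourings with m and K = m - 1 colours, [Im] and [IK] the weighted numbers of
   independent sets, [S] the sum of deg (deg - 1), and [sg], [rK] and [Y] count colourings
   with one colour, with at least two of K colours, and with at least two colours from some
   neighbourhood. *)
Lemma count_bound_small (m e Qm QK Im IK sg rK Y S bm bK : nat) :
  5 <= m < 9 -> 0 < e <= m * m.-1 ->
  Qm * (m.+1 ^ m) ^ m <= Im ^ m * m.+1 ^ m ->
  m.+1 ^ m = m ^ m + m * m ^ m.-1 + bm ->
  Im * (m * m.-1) + e * bm <= m.+1 ^ m * (m * m.-1) ->
  QK * (m ^ m) ^ m.-1 <= IK ^ m.-1 * m ^ m ->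
  m ^ m = m.-1 ^ m + m * m.-1 ^ m.-1 + bK ->
  IK * (m * m.-1) + e * bK <= m ^ m * (m * m.-1) ->
  QK = 1 + m.-1 * sg + rK -> Y * (m.-1 * m.-2) <= S * rK ->
  2 * m.-1 * S + 3 * m.-1 * e <= e * (e + m.-1 * m.-1) -> sg <= 2 ^ m ->
  Qm + e * sg + Y < m.+1 ^ m.
Proof.
move=> /andP[m5 m9] /andP[e0 eB] hQm hbm hIm hQK hbK hIK hrK hY hS hsg.
have mem : m \in iota 5 4 by rewrite mem_iota; lia.
have meme : e \in iota 1 (m * m.-1) by rewrite mem_iota e0 add1n ltnS.
have := allP (allP small_checkP m mem) e meme.
rewrite /small_check.
set K := m.-1 in hIm hQK hbK hIK hrK hY hS eB *.
have EK : (Z.of_nat m - 1 = Z.of_nat K)%BZ by rewrite /K; lia.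
have E1 : (Z.of_nat m + 1 = Z.of_nat m.+1)%BZ by lia.
rewrite EK E1 -!Z_of_expn.
have mm : m ^ m = m * m ^ K by rewrite -expnS prednK //; lia.
have B0 : 0 < m * K by rewrite /K; lia.
have N0 : 0 < m.+1 ^ m by rewrite expn_gt0.
have M0 : 0 < m ^ m by rewrite expn_gt0; lia.
have p1 : Qm * (m * K * m.+1 ^ m) ^ m <= m.+1 ^ m * (m * K * m.+1 ^ m - e * bm) ^ m.
  by apply: scale_bound hQm hIm; apply: leq_trans m5.
have p2 : QK * (m * K * m ^ m) ^ K <= m ^ m * (m * K * m ^ m - e * bK) ^ K.
  by apply: scale_bound hQK hIK; rewrite /K; case: (m) m5 => // -[].
have {}mm : m * m ^ K = m ^ m by rewrite mm.
have d1 : e * bm <= m * K * m.+1 ^ m.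
  by rewrite [X in _ <= X]mulnC; apply: leq_trans hIm; apply: leq_addl.
have d2 : e * bK <= m * K * m ^ m.
  by rewrite [X in _ <= X]mulnC; apply: leq_trans hIK; apply: leq_addl.
(* Since [m * m ^ K = m ^ m], here [bm] is [m.+1 ^ m - 2 * m ^ m]. *)
have x1 : (Z.of_nat m * Z.of_nat K * Z.of_nat (m.+1 ^ m) -
    Z.of_nat e * (Z.of_nat (m.+1 ^ m) - 2 * Z.of_nat (m ^ m)) =
    Z.of_nat (m * K * m.+1 ^ m - e * bm))%BZ.
  move: hbm d1; rewrite mm; move: (m.+1 ^ m) (m ^ m) => a b -> d1; clear -d1.
  rewrite Nat2Z.inj_sub; [lia|exact/leP].
have x2 : (Z.of_nat m * Z.of_nat K * Z.of_nat (m ^ m) -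
    Z.of_nat e * (Z.of_nat (m ^ m) - Z.of_nat (K ^ m) - Z.of_nat m * Z.of_nat (K ^ K)) =
    Z.of_nat (m * K * m ^ m - e * bK))%BZ.
  move: hbK d2; move: (K ^ m) (K ^ K) (m ^ m) => a b c -> d2; clear -d2.
  rewrite Nat2Z.inj_sub; [lia|exact/leP].
rewrite x1 x2.
have -> : (Z.of_nat m * Z.of_nat K * Z.of_nat (m.+1 ^ m) = Z.of_nat (m * K * m.+1 ^ m))%BZ.
  by rewrite !Nat2Z.inj_mul.
have -> : (Z.of_nat m * Z.of_nat K * Z.of_nat (m ^ m) = Z.of_nat (m * K * m ^ m))%BZ.
  by rewrite !Nat2Z.inj_mul.
rewrite -[2%BZ]/(Z.of_nat 2) -!Z_of_expn => /andP[/Z.leb_le c1 /Z.ltb_lt c2].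
apply/ltP/Nat2Z.inj_lt; rewrite !Nat2Z.inj_add Nat2Z.inj_mul.
have K4 : 3 < K by rewrite /K; clear -m5; lia.
apply: (combine_bounds (QK := Z.of_nat QK)) c1 c2.
- by apply/(Nat2Z.inj_lt 0)/ltP; rewrite expn_gt0 muln_gt0 B0 N0.
- by apply/(Nat2Z.inj_lt 0)/ltP; rewrite expn_gt0 muln_gt0 B0 M0.
- clear -K4; nia.
- clear -K4; nia.
- by rewrite -!Nat2Z.inj_mul; apply/(Nat2Z.inj_le)/leP.
- by rewrite -!Nat2Z.inj_mul; apply/(Nat2Z.inj_le)/leP.
- have -> : (Z.of_nat QK - 1 - Z.of_nat K * Z.of_nat sg = Z.of_nat rK)%BZ by clear -hrK; lia.
  clear -hY hS K4.
  have : Y * (2 * K * K * K.-1) <= (2 * K * S) * rK by nia.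
  have : (2 * K * S + 3 * K * e) * rK <= e * (e + K * K) * rK by rewrite leq_mul2r hS orbT.
  nia.
- by apply/(Nat2Z.inj_le)/leP.
Qed.
End Numeric.

(** * Orders at least nine, by estimates in an ordered field *)

Section LargeOrder.
Import Order.TTheory GRing.Theory Num.Theory.
Local Open Scope ring_scope.
Variable R : realFieldType.
Implicit Types x y : R.

Lemma expr1D_ge2 y k : 0 <= y ->
  1 + k%:R * y + (k%:R * (k%:R - 1)) / 2 * y ^+ 2 <= (1 + y) ^+ k.
Proof.
move=> y0; elim: k => [|k IH]; first by rewrite !mul0r !addr0 expr0.
rewrite [leRHS]exprS; have y1p : 0 <= 1 + y by lra.
apply: (le_trans _ (ler_wpM2l y1p IH)).
have k0 : 0 <= k%:R * (k%:R - 1) :> R.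
  by case: k {IH} => [|k]; rewrite ?mul0r // mulr_ge0 // subr_ge0 ler1n.
have : 0 <= k%:R * (k%:R - 1) * y ^+ 3 :> R by rewrite mulr_ge0 // exprn_ge0.
by rewrite -natr1; nra.
Qed.

(** [Q / P] is at most [(1 - y) ^ k], hence at most the inverse of [(1 + y) ^ k], as
    [(1 - y) * (1 + y) <= 1]; the latter power is cut after its quadratic term. *)
Lemma ratio_bound (Q P I y : R) k : 0 < P -> 0 <= I -> 0 <= y ->
  Q * P ^+ k <= I ^+ k * P -> I <= P * (1 - y) ->
  0 <= Q ->
  Q * (1 + k%:R * y + (k%:R * (k%:R - 1)) / 2 * y ^+ 2) <= P.
Proof.
move=> P0 I0 y0 hQ hI Q0.
apply: (le_trans (ler_wpM2l Q0 (expr1D_ge2 k y0))).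
rewrite -(ler_pM2r (exprn_gt0 k P0)) mulrAC.
have y1p : 0 <= 1 + y by lra.
apply: (le_trans (ler_wpM2r (exprn_ge0 k y1p) hQ)).
rewrite mulrAC -exprMn mulrC ler_pM2l //; apply: lerXn2r; rewrite ?nnegrE ?mulr_ge0 //; try lra.
apply: (le_trans (ler_wpM2r y1p hI)).
rewrite -mulrA -[leRHS]mulr1 ler_pM2l //; nra.
Qed.

Lemma bernoulli_ge y k : -1 <= y -> 1 + k%:R * y <= (1 + y) ^+ k.
Proof.
move=> y1; elim: k => [|k IH]; first by rewrite mul0r addr0.
rewrite exprS; have y1p : 0 <= 1 + y by lra.
apply: (le_trans _ (ler_wpM2l y1p IH)).
have : 0 <= k%:R * y ^+ 2 by rewrite mulr_ge0 // exprn_even_ge0.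
by rewrite -natr1; lra.
Qed.

(** With [a = m + 1] this amounts to Bernoulli's [(1 - 1 / a ^ 2) ^ a >= 1 - 1 / a]. *)
Lemma expn_ratio_decr m : (0 < m)%N ->
  m.+1%:R ^+ m.+1 / m.+2%:R ^+ m.+1 <= m%:R ^+ m / m.+1%:R ^+ m :> R.
Proof.
move=> m0; set a : R := m.+1%:R.
have a0 : 1 < a by rewrite /a ltr1n.
have -> : m%:R = a - 1 :> R by rewrite /a -natr1 addrK.
have -> : m.+2%:R = a + 1 :> R by rewrite -natr1.
have a2 : 0 < a ^- 2 by rewrite invr_gt0 exprn_gt0; lra.
have a2' : a ^- 2 <= 1 by rewrite invf_le1 ?exprn_gt0 ?exprn_ege1; lra.
have am1 : -1 <= - a ^- 2 by rewrite lerN2.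
have h := bernoulli_ge m.+1 am1.
have e1 : 1 + - a ^- 2 = (a - 1) * (a + 1) / a ^+ 2 by field; lra.
have e2 : 1 + m.+1%:R * - a ^- 2 = (a - 1) / a by rewrite -/a; field; lra.
rewrite e1 e2 !exprMn exprVn -exprM mulnC exprM in h.
have ap : 0 < a by lra.
have ap1 : 0 < a + 1 by lra.
rewrite ler_pdivrMr ?exprn_gt0 // mulrAC ler_pdivlMr ?exprn_gt0 //.
move: h; rewrite ler_pdivlMr ?exprn_gt0 // !exprS expr0.
have b0 : 0 < a - 1 by lra.
move: ((a - 1) ^+ m) ((a + 1) ^+ m) (a ^+ m) => u v w h.
have ai : a != 0 by lra.
have : (a - 1) * (a * w * w) <= (a - 1) * (u * ((a + 1) * v)).
  suff : (a - 1) * (a * w * w) <= (a - 1) * u * ((a + 1) * v) by lra.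
  apply: (le_trans _ h); rewrite le_eqVlt; apply/orP; left; apply/eqP; field.
  by rewrite nat1r pnatr_eq0.
by rewrite ler_pM2l.
Qed.

Lemma expn_ratio_le m k (c : R) : (0 < m <= k)%N -> m%:R ^+ m <= c * m.+1%:R ^+ m ->
  k%:R ^+ k <= c * k.+1%:R ^+ k.
Proof.
case/andP=> m0 mk hc; rewrite -ler_pdivrMr ?exprn_gt0 ?ltr0n //.
rewrite -(subnKC mk); elim: (k - m)%N => [|i IH].
  by rewrite addn0 ler_pdivrMr // exprn_gt0 ?ltr0n.
by rewrite addnS; apply: (le_trans _ IH); apply: expn_ratio_decr; rewrite addn_gt0 m0.
Qed.

(** Makes the one-colour term negligible; the cube absorbs the factor [m - 1] of [e] and the bound
    [(m + 1) ^ 2] on [D] in [large_arith]. *)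
Lemma expn_large m : (9 <= m)%N -> (100 * 2 ^ m * m.+1 ^ 3 <= m.+1 ^ m)%N.
Proof.
move=> m9; have -> : (m.+1 ^ m = m.+1 ^ (m - 3) * m.+1 ^ 3)%N.
  by rewrite -expnD subnK //; apply: leq_trans m9.
rewrite leq_mul2r; apply/orP; right.
apply: (@leq_trans (10 ^ (m - 3))); last by rewrite leq_exp2r; lia.
have -> : (m - 3 = 6 + (m - 9))%N by lia.
rewrite -{1}(subnKC m9) !expnD mulnA; apply: leq_mul; first by lia.
by case: (m - 9)%N => // i; rewrite leq_exp2r.
Qed.

(** Applied with [p = m] and [x = e / (m - 1)]. The constant [9 / 40] is [1 - 2 * 31 / 80], where
    [31 / 80] slightly exceeds [(9 / 10) ^ 9]. *)
Lemma quad_ge_top (p t x : R) : 9%:R <= p -> 0 <= x -> 9%:R / 40%:R * x <= p * t ->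
  1 + 22%:R / 100%:R * x + 9%:R / 400%:R * x ^+ 2 <=
    1 + p * t + (p * (p - 1)) / 2 * t ^+ 2.
Proof.
move=> p9 x0 h.
have h2 : (9%:R / 40%:R * x) ^+ 2 <= (p * t) ^+ 2 by apply: lerXn2r; rewrite ?nnegrE; lra.
have q : 8%:R / 9%:R * p ^+ 2 <= p * (p - 1) by nra.
have h3 := ler_wpM2r (sqr_ge0 t) q.
by move: h2 h3; rewrite !exprMn => h2 h3; lra.
Qed.

(* [1559 / 4000] is slightly more than [(8 / 9) ^ 8]. *)
Lemma quad_ge_pred (p t x : R) : 9%:R <= p -> 0 <= x ->
  x * (p - 1559%:R / 4000%:R * (2 * p - 1)) <= p ^+ 2 * t ->
  1 + 22%:R / 100%:R * x + 9%:R / 400%:R * x ^+ 2 <=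
    1 + (p - 1) * t + ((p - 1) * (p - 1 - 1)) / 2 * t ^+ 2.
Proof.
move=> p9 x0 h; set l := p - _ in h.
have l0 : 0 <= l by rewrite /l; lra.
have p2 : 0 < p ^+ 2 by rewrite exprn_gt0 //; lra.
have h1 : 22%:R / 100%:R * x <= (p - 1) * t.
  rewrite -(ler_pM2l p2).
  have q : 22%:R / 100%:R * p ^+ 2 <= (p - 1) * l by rewrite /l; nra.
  have := ler_wpM2r x0 q; have p1 : 0 <= p - 1 by lra.
  by have := ler_wpM2l p1 h; lra.
have h2 : 9%:R / 400%:R * x ^+ 2 <= ((p - 1) * (p - 1 - 1)) / 2 * t ^+ 2.
  rewrite -(ler_pM2l (exprn_gt0 2 p2)).
  have xl : (x * l) ^+ 2 <= (p ^+ 2 * t) ^+ 2.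
    have xl0 : 0 <= x * l by rewrite mulr_ge0.
    by apply: lerXn2r => //; rewrite nnegrE; apply: le_trans h.
  have q : 9%:R / 400%:R * p ^+ 4 <= ((p - 1) * (p - 1 - 1)) / 2 * l ^+ 2.
    rewrite /l; have [u [-> u0]] : exists u : R, p = 9%:R + u /\ 0 <= u.
      by exists (p - 9%:R); split; lra.
    have u2 : 0 <= u ^+ 2 by rewrite exprn_ge0.
    have u3 : 0 <= u ^+ 3 by rewrite exprn_ge0.
    have u4 : 0 <= u ^+ 4 by rewrite exprn_ge0.
    by lra.
  have := ler_wpM2r (sqr_ge0 x) q.
  have c0 : 0 <= (p - 1) * (p - 1 - 1) / 2 by rewrite divr_ge0 // mulr_ge0 //; lra.
  have := ler_wpM2l c0 xl; rewrite !exprMn; lra.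
by lra.
Qed.

(** After multiplication by [D], the term [Qm] takes at most [N] and leaves [N * (D - 1)]. Relative
    to [N], [Y] takes at most [31 / 160 * x + 31 / 1440 * x ^ 2] and [es] at most [x / 100],
    together less than [D - 1]. *)
Lemma large_arith (p x N M Qm QK Y es W D : R) :
  9%:R <= p -> 0 < x -> x <= p -> 0 < N -> M <= 31%:R / 80%:R * N ->
  D = 1 + 22%:R / 100%:R * x + 9%:R / 400%:R * x ^+ 2 ->
  Qm * D <= N -> QK * D <= M -> Y <= x / 2 * (1 + x / p) * QK -> 0 <= QK ->
  es <= x * W -> 0 <= W -> 100%:R * W * (p + 1) ^+ 2 <= N -> Qm + es + Y < N.
Proof.
move=> p9 x0 xp N0 hM hD hQm hQK hY QK0 hes W0 hW.
have x2 : 0 < x ^+ 2 by rewrite exprn_gt0.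
have D0 : 0 < D by lra.
have xx : x ^+ 2 <= p ^+ 2 by apply: lerXn2r; rewrite ?nnegrE; lra.
have Dp : D <= (p + 1) ^+ 2 by rewrite hD; lra.
have ip : p^-1 <= 9%:R^-1 by rewrite lef_pV2 ?posrE; lra.
have hY2 : Y <= (x / 2 + x ^+ 2 / 18%:R) * QK.
  apply: (le_trans hY); rewrite ler_wpM2r //.
  have : x ^+ 2 * p^-1 <= x ^+ 2 * 9%:R^-1 by rewrite ler_pM2l.
  lra.
have g1 : Y * D <= (x / 2 + x ^+ 2 / 18%:R) * M.
  apply: (le_trans (ler_wpM2r (ltW D0) hY2)); rewrite -mulrA ler_wpM2l //; lra.
have g2 : (x / 2 + x ^+ 2 / 18%:R) * M <= (x / 2 + x ^+ 2 / 18%:R) * (31%:R / 80%:R * N).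
  by rewrite ler_wpM2l //; lra.
have g3 : es * D <= x * (W * (p + 1) ^+ 2).
  apply: (le_trans (ler_wpM2r (ltW D0) hes)); rewrite -mulrA ler_pM2l //.
  by rewrite ler_wpM2l.
have g4 : x * (W * (p + 1) ^+ 2) <= x * (N / 100%:R) by rewrite ler_pM2l //; lra.
have xN : 0 < x * N by rewrite mulr_gt0.
have x2N : 0 < x ^+ 2 * N by rewrite mulr_gt0.
rewrite -(ltr_pM2r D0) !mulrDl hD.
rewrite hD in hQm g1 g3; lra.
Qed.

Lemma count_bound_large (m e Qm QK Im IK sg rK Y S bm bK : nat) : (
  9 <= m -> 0 < e <= m * m.-1 ->
  Qm * (m.+1 ^ m) ^ m <= Im ^ m * m.+1 ^ m ->
  m.+1 ^ m = m ^ m + m * m ^ m.-1 + bm ->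
  Im * (m * m.-1) + e * bm <= m.+1 ^ m * (m * m.-1) ->
  QK * (m ^ m) ^ m.-1 <= IK ^ m.-1 * m ^ m ->
  m ^ m = m.-1 ^ m + m * m.-1 ^ m.-1 + bK ->
  IK * (m * m.-1) + e * bK <= m ^ m * (m * m.-1) ->
  QK = 1 + m.-1 * sg + rK -> Y * (m.-1 * m.-2) <= S * rK ->
  2 * m.-1 * S + 3 * m.-1 * e <= e * (e + m.-1 * m.-1) -> sg <= 2 ^ m ->
  Qm + e * sg + Y < m.+1 ^ m)%N.
Proof.
move=> m9 /andP[e0 eB] hQm hbm hIm hQK hbK hIK hrK hY hS hsg.
case: m m9 eB hQm hbm hIm hQK hbK hIK hrK hY hS hsg => // k.
move=> m9 eB hQm hbm hIm hQK hbK hIK hrK hY hS hsg.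
rewrite /= in eB hbm hIm hQK hbK hIK hrK hY hS.
have r1 : k.+1%:R ^+ k.+1 <= 31%:R / 80%:R * k.+2%:R ^+ k.+1 :> R.
  by apply: (@expn_ratio_le 9); [exact: m9|clear; lra].
have r2 : k%:R ^+ k <= 1559%:R / 4000%:R * k.+1%:R ^+ k :> R.
  by apply: (@expn_ratio_le 8); [exact: m9|clear; lra].
have r3 := expn_large m9.
set m := k.+1 in m9 eB hQm hbm hIm hQK hbK hIK hrK hY hS hsg r1 r2 r3 *.
have kp : 8%:R <= k%:R :> R by rewrite ler_nat.
have kp0 : 0 < k%:R :> R by apply: lt_le_trans kp; rewrite ltr0n.
have [p pE] : exists q : R, q = m%:R by exists m%:R.
have pk : k%:R = p - 1 by rewrite pE -natr1 addrK.
have p9 : 9%:R <= p by rewrite pE ler_nat.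
(* [x] is [m] times the edge density, hence at most [p]. *)
have [x xE] : exists y : R, y = e%:R / k%:R by exists (e%:R / k%:R).
have ex : e%:R = x * (p - 1) :> R.
  by rewrite xE -pk divfK // gt_eqF.
have x0 : 0 < x by rewrite xE; apply: divr_gt0 => //; rewrite ltr0n.
have xp : x <= p by rewrite xE pE ler_pdivrMr // -natrM ler_nat.
move: hQm hbm hIm hQK hbK hIK hY hS hsg r3.
rewrite -(ler_nat R) !natrM !natrX => hQm /(congr1 (fun n => n%:R : R)).
rewrite !natrD !natrM !natrX => hbm.
rewrite -(ler_nat R) !natrD !natrM !natrX => hIm.
rewrite -(ler_nat R) !natrM !natrX => hQK /(congr1 (fun n => n%:R : R)).
rewrite !natrD !natrM !natrX => hbK.
rewrite -(ler_nat R) !natrD !natrM !natrX => hIK.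
rewrite -(ler_nat R) !natrM => hY.
rewrite -(ler_nat R) !(natrD, natrM) => hS.
rewrite -(ler_nat R) !natrX => hsg.
rewrite -(ler_nat R) !natrM !natrX => r3.
rewrite -(ltr_nat R) !natrD natrM natrX.
have hQKr : rK%:R <= QK%:R :> R by rewrite ler_nat hrK leq_addl.
have pk1 : k.-1%:R = p - 2 :> R.
  have k1 : (0 < k)%N by rewrite -(ltr0n R).
  by have := natr1 k.-1 : _ = _ :> R; rewrite prednK // pk; clear; lra.
have m1E : m.+1%:R = p + 1 by rewrite pE -natr1.
rewrite -pE in hbm hIm hQK hbK hIK r1 r2.
rewrite m1E in hQm hbm hIm r1 r3 *.
rewrite pk in hbm hIm hQK hbK hIK hY hS r2.
rewrite pk1 in hY.
have [p0 pp1 pm1 pm2] : [/\ 0 < p, 0 < p + 1, 0 < p - 1 & 0 < p - 2].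
  by clear -p9; split; lra.
have N0 : 0 < (p + 1) ^+ m by rewrite exprn_gt0.
have M0 : 0 < p ^+ m by rewrite exprn_gt0.
have MS : p * p ^+ k = p ^+ m by rewrite -exprS.
have KS : (p - 1) ^+ m = (p - 1) * (p - 1) ^+ k by rewrite -exprS.
have KK0 : 0 <= (p - 1) ^+ k by rewrite exprn_ge0 // ltW.
have bmge : 9%:R / 40%:R * (p + 1) ^+ m <= bm%:R by clear -hbm MS r1; lra.
(* Here [bK] equals [p ^ m - (2 * p - 1) * (p - 1) ^ k], and [r2] bounds the subtracted power. *)
have bKge : (p - 1559%:R / 4000%:R * (2 * p - 1)) * p ^+ m <= p * bK%:R.
  have c0 : 0 <= p * (2 * p - 1) by rewrite mulr_ge0 //; clear -p9; lra.
  have h := ler_wpM2l c0 r2.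
  have := congr1 ( *%R p) hbK; rewrite KS; move: h; rewrite -MS; clear; lra.
have pk0 : 0 < p * (p - 1) by rewrite mulr_gt0.
have yE (P : R) (b : nat) : 0 < P -> p * (e%:R * b%:R / (p * (p - 1) * P)) = x * (b%:R / P).
  by move=> P0; rewrite ex; clear -P0 p0 pm1; field; rewrite !gt_eqF.
have yi (P I : R) (b : nat) : 0 < P -> I * (p * (p - 1)) + e%:R * b%:R <= P * (p * (p - 1)) ->
    I <= P * (1 - e%:R * b%:R / (p * (p - 1) * P)).
  move=> P0 h; rewrite -(ler_pM2r pk0).
  have -> : P * (1 - e%:R * b%:R / (p * (p - 1) * P)) * (p * (p - 1)) =
      P * (p * (p - 1)) - e%:R * b%:R.
    by clear -P0 p0 pm1; field; rewrite !gt_eqF.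
  by rewrite lerBrDr.
have y0 (P : R) (b : nat) : 0 < P -> 0 <= e%:R * b%:R / (p * (p - 1) * P).
  by move=> P0; rewrite divr_ge0 ?mulr_ge0 // ltW // mulr_gt0.
have hm := ratio_bound N0 (ler0n _ Im) (y0 _ bm N0) hQm (yi _ _ _ N0 hIm) (ler0n _ Qm).
have hk := ratio_bound M0 (ler0n _ IK) (y0 _ bK M0) hQK (yi _ _ _ M0 hIK) (ler0n _ QK).
have z0 : 0 <= 2 ^+ m :> R by rewrite exprn_ge0.
apply: (@large_arith p x _ (p ^+ m) _ QK%:R _ _ ((p - 1) * 2 ^+ m) _ p9 x0 xp N0 r1 erefl) => //.
- apply: (le_trans _ hm); rewrite ler_wpM2l // -pE.
  apply: (quad_ge_top p9 (ltW x0)); rewrite yE // mulrC ler_pM2l //.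
  by rewrite ler_pdivlMr.
- apply: (le_trans _ hk); rewrite ler_wpM2l // pk.
  have p2E t : p ^+ 2 * t = p * (p * t) by rewrite mulrA -expr2.
  apply: (quad_ge_pred p9 (ltW x0)); rewrite p2E yE // [leRHS]mulrCA ler_pM2l //.
  by rewrite mulrA ler_pdivlMr.
- have hS2 : S%:R <= x / 2 * ((p - 1) * (x + (p - 1) - 3%:R)).
    rewrite ex in hS.
    have k1 : 0 < 2 * (p - 1) by rewrite mulr_gt0.
    by rewrite -(ler_pM2l k1); clear -hS; lra.
  have hY2 : Y%:R * ((p - 1) * (p - 2)) <= x / 2 * ((p - 1) * (x + (p - 1) - 3%:R)) * QK%:R.
    by apply: (le_trans hY); apply: ler_pM.
  have kk0 : 0 < (p - 1) * (p - 2) by rewrite mulr_gt0.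
  rewrite -(ler_pM2r kk0); apply: (le_trans hY2).
  rewrite [leRHS]mulrAC ler_wpM2r //.
  have -> : x / 2 * (1 + x / p) * ((p - 1) * (p - 2)) =
      x / 2 * ((p - 1) * ((p - 2) + x - 2 * (x / p))).
    by clear -p0; field; rewrite gt_eqF.
  rewrite ler_pM2l ?divr_gt0 // ler_pM2l //.
  have : x / p <= 1 by rewrite ler_pdivrMr // mul1r.
  by clear; lra.
- by rewrite ex -mulrA ler_pM2l // ler_wpM2l // ltW.
- by rewrite mulr_ge0 // ltW.
- apply: (le_trans _ r3).
  have z1 : 0 <= 2 ^+ m * (p + 1) ^+ 2 by rewrite mulr_ge0 // exprn_ge0 // ltW.
  by clear -z1; lra.
Qed.
End LargeOrder.

Lemma expnS_ge2 x m : x ^ m + m * x ^ m.-1 <= x.+1 ^ m.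
Proof.
case: m => [|m]; first by rewrite !expn0.
elim: m => [|m IH]; first by rewrite !expn1 expn0 muln1 addn1.
rewrite expnS; apply: leq_trans (leq_mul (leqnn _) IH).
by rewrite /= !expnS; move: (x ^ m) => y; nia.
Qed.

Lemma colouring_bound (V : finType) (g : rel V) :
  symmetric g -> irreflexive g -> 5 <= #|V| -> 0 < arcs g ->
  ncol g #|V| 1 setT + \sum_v ncol g (deg g v) 1 setT < #|V|.+1 ^ #|V| + #|V|.
Proof.
move=> gsym girr m5 a0; set m := #|V| in m5 *.
have m1 : m.-1.+1 = m by rewrite prednK // (leq_trans _ m5).
have degm v : deg g v < m by rewrite -m1 ltnS deg_le.
have m3 : 2 < m by apply: leq_trans m5.
(* The blank colourings, one for each [v], make up the [m] on the right-hand side. *)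
have -> : \sum_v ncol g (deg g v) 1 setT =
    m + arcs g * nsurj g 1 setT + \sum_v ncol_ge2 g (deg g v).
  under eq_bigr => v _ do rewrite ncol_split //.
  by rewrite !big_split /= sum1_card -big_distrl.
suff : ncol g m 1 setT + arcs g * nsurj g 1 setT + \sum_v ncol_ge2 g (deg g v) <
  m.+1 ^ m by clear; lia.
have aB : 0 < arcs g <= m * m.-1.
  rewrite a0 /arcs /= -sum_nat_const; apply: leq_sum => v _; exact: deg_le.
have m0 : 0 < m by apply: leq_trans m5.
have K0 : 0 < m.-1 by rewrite -ltnS m1; apply: leq_trans m5.
have uK := ncol_upper g K0.
have um := ncol_upper g m0.
have V1 : 1 < #|V| by apply: leq_trans m5.
have eb x : x.+1 ^ m = x ^ m + m * x ^ m.-1 + (x.+1 ^ m - (x ^ m + m * x ^ m.-1)).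
  by rewrite subnKC // expnS_ge2.
have wm := indep_weight_upper girr V1 (eb m).
have wK := indep_weight_upper girr V1 (eb m.-1).
have ebK := eb m.-1.
rewrite m1 -/m in uK wK ebK.
have sp := @ncol_split V g m.-1 m3; rewrite -/m -{2}m1 in sp.
have hY : (\sum_v ncol_ge2 g (deg g v)) * (m.-1 * m.-2) <=
    (\sum_v deg g v * (deg g v).-1) * ncol_ge2 g m.-1.
  rewrite !big_distrl; apply: leq_sum => v _; apply: ncol_ge2_scale.
  exact: deg_le.
have dc := de_caen gsym girr.
have [m9|m9] := ltnP m 9.
  apply: (count_bound_small _ aB um (eb m) wm uK ebK wK (sp (leqnn _)) hY dc (nsurj1 _ _)).
  by rewrite m5.
exact: (count_bound_large rat m9 aB um (eb m) wm uK ebK wK (sp (leqnn _)) hY dc (nsurj1 _ _)).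
Qed.

(** * Suffix-free automata *)

Section SuffixFree.
Variables (n : nat) (Sigma : finType) (delta : Sigma -> 'I_n -> 'I_n).
Variables (s : 'I_n) (F : {set 'I_n}).
Hypotheses (n7 : 7 <= n) (Hmin : minimal delta s F) (Hsf : suffix_free delta s F).

Local Notation run := (run delta).

Lemma run_cat q u v : run q (u ++ v) = run (run q u) v.
Proof. exact: foldl_cat. Qed.

Lemma reach q : exists w, run s w = q.
Proof. by have [] := Hmin. Qed.

Lemma reach_neq q : q != s -> exists2 w, w <> [::] & run s w = q.
Proof.
by move=> qs; have [w wq] := reach q; exists w => // w0; rewrite -wq w0 eqxx in qs.
Qed.

(** Otherwise [w] would be a proper suffix of the accepted word [v ++ w]. *)
Lemma run_disjoint v w : v <> [::] -> run s w \in F -> run (run s v) w \notin F.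
Proof.
move=> v0 sw; apply/negP; rewrite -run_cat => svw.
have /(congr1 size) := Hsf svw sw (suffix_suffix _ _).
by rewrite size_cat; case: v v0 {svw} => //= a v _; lia.
Qed.

Lemma exists_other (q : 'I_n) : exists q', q' != q.
Proof.
have : 0 < #|predC1 q| by have := cardC1 q; rewrite card_ord => ->; lia.
by case/card_gt0P => q'; rewrite inE; exists q'.
Qed.

(** Two powers of a letter, with exponents [i < j], lead from [s] to one state. A word accepted from
    there would complete both powers to accepted words, one a proper suffix of the other. *)
Lemma exists_sink : exists e, forall w, run e w \notin F.
Proof.
apply: NNPP => none.
have [q qs] := exists_other s.
have [[//|a _] _ _] := reach_neq qs.
have : ~~ injectiveb (fun i : 'I_n.+1 => run s (nseq i a)).
  by apply/injectiveP => /leq_card; rewrite !card_ord ltnn.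
move/injectivePn => [i [j ij /esym eqij]].
wlog ltij : i j ij eqij / i < j.
  move=> W; have [lij|lji|/val_inj E] := ltngtP i j; first exact: W eqij lij.
    by apply: W (esym eqij) lji; rewrite eq_sym.
  by rewrite E eqxx in ij.
apply: none; exists (run s (nseq i a)) => w; apply/negP => acc.
have ji : nseq (j - i) a <> [::] by move/(congr1 size); rewrite size_nseq /=; lia.
have := @run_disjoint _ (nseq i a ++ w) ji; rewrite -run_cat catA -nseqD subnK ?(ltnW ltij) //.
by rewrite !run_cat eqij acc => /(_ isT).
Qed.

Definition sink := proj1_sig (constructive_indefinite_description _ exists_sink).
Local Notation e := sink.

Lemma sinkP w : run e w \notin F.
Proof. exact: (proj2_sig (constructive_indefinite_description _ exists_sink)). Qed.

Lemma sink_unique q : (forall w, run q w \notin F) -> q = e.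
Proof.
move=> qF; have [_ dist] := Hmin; apply: dist => w.
by rewrite (negbTE (qF w)) (negbTE (sinkP w)).
Qed.

Lemma run_sink w : run e w = e.
Proof. by apply: sink_unique => x; rewrite -run_cat sinkP. Qed.

Lemma accepting q : q != e -> exists w, run q w \in F.
Proof.
move=> /eqP qe; apply: NNPP => none; apply: qe; apply: sink_unique => w.
by apply/negP => h; apply: none; exists w.
Qed.

Lemma init_neq_sink : s != e.
Proof.
apply/eqP => se; have [q /eqP qs] := exists_other s; apply: qs.
by have [w <-] := reach q; rewrite {1}se run_sink.
Qed.

(** A non-empty loop at [s] could be put in front of any accepted word. *)
Lemma run_neq_init q w : w <> [::] -> run q w != s.
Proof.
move=> w0; apply/eqP => qw; have [v vq] := reach q.
have [x sx] := accepting init_neq_sink.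
have vw0 : v ++ w <> [::] by case: v {vq} => //.
by have /negP := run_disjoint vw0 sx; apply; rewrite run_cat vq qw.
Qed.

Definition core := {q : 'I_n | (q != s) && (q != e)}.

Lemma core_neq_init (q : core) : val q != s.
Proof. by have /andP[] := valP q. Qed.

Lemma core_neq_sink (q : core) : val q != e.
Proof. by have /andP[] := valP q. Qed.

Lemma card_core : #|{: core}| = n - 2.
Proof.
have h := cardC (pred2 s e); rewrite card2 init_neq_sink card_ord in h.
have -> : n - 2 = #|[predC pred2 s e]|.
  by apply/eqP; rewrite -(eqn_add2l 2) [_ + #|_|]h subnKC //; apply: leq_trans n7.
by rewrite card_sig; apply: eq_card => q; rewrite !inE negb_or.
Qed.

(** If [v] leads from [s] to [q], then [w ++ x] is a proper suffix of [v ++ w ++ x]. *)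
Lemma disjoint_images w (q : core) x : run (run s w) x \in F -> run (run (val q) w) x \notin F.
Proof.
have [v v0 <-] := reach_neq (core_neq_init q).
by rewrite -!run_cat catA => h; rewrite -catA run_cat; apply: run_disjoint.
Qed.

(** Excluded middle turns the existential over all words into a finite set. *)
Definition trans_semigroup : {set {ffun 'I_n -> 'I_n}} :=
  [set t | if excluded_middle_informative (in_trans_semigroup delta t) then true else false].
Local Notation T := trans_semigroup.

Lemma trans_semigroupP t : t \in T <-> in_trans_semigroup delta t.
Proof. by rewrite inE; case: excluded_middle_informative. Qed.

Lemma mem_trans_semigroup t : t \in T -> exists2 w, w <> [::] & t =1 run^~ w.
Proof.
move/trans_semigroupP => [w [w0 ->]]; exists w => // q; by rewrite ffunE.
Qed.

(** * Colliding states and the encoding by colourings *)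

Definition collides (p r : core) :=
  [exists t in T, (t s == val p) && [exists q : core, t (val q) == val r]].

Definition colliding : rel core := fun p r => collides p r || collides r p.

Lemma colliding_sym : symmetric colliding.
Proof. by move=> p r; rewrite /colliding orbC. Qed.

Lemma colliding_disjoint p r x :
  colliding p r -> ~~ ((run (val p) x \in F) && (run (val r) x \in F)).
Proof.
have H p' r' : collides p' r' -> ~~ ((run (val p') x \in F) && (run (val r') x \in F)).
  case/existsP => t /andP[tT /andP[/eqP tp /existsP[q /eqP tq]]].
  have [w _ tw] := mem_trans_semigroup tT; rewrite -tp -tq !tw.
  by apply/negP => /andP[/(disjoint_images q)/negP].
by case/orP => /H //; rewrite andbC.
Qed.

Lemma colliding_irr : irreflexive colliding.
Proof.
move=> p; apply/negP => pp; have [x px] := accepting (core_neq_sink p).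
by have := colliding_disjoint x pp; rewrite px.
Qed.

(** A word accepted from the common image would yield one accepted from both [p] and [r]. *)
Lemma colliding_unfocused t p r :
  t \in T -> colliding p r -> t (val p) = t (val r) -> t (val p) = e.
Proof.
case/mem_trans_semigroup => w _ tw pr; rewrite !tw => E.
apply/eqP; apply: contraT => /accepting[x px].
by have := colliding_disjoint (w ++ x) pr; rewrite !run_cat -E px.
Qed.

(** Both [s] and the sink give [None]; as [s] is never an image under the semigroup, [None] stands
    for the sink there. *)
Definition to_core (q : 'I_n) : option core := insub q.

Lemma to_core_Some q p : to_core q = Some p -> q = val p.
Proof. by rewrite /to_core; case: insubP => // u _ uq [<-]. Qed.

Lemma to_core_None q : q != s -> to_core q = None -> q = e.
Proof.
move=> qs; rewrite /to_core; case: insubP => // + _.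
by rewrite qs /= negbK => /eqP.
Qed.

Lemma to_core_sink : to_core e = None.
Proof. by rewrite /to_core insubF // eqxx andbF. Qed.

Definition encode (t : {ffun 'I_n -> 'I_n}) : option core * {ffun core -> option core} :=
  (to_core (t s), [ffun q => to_core (t (val q))]).

Lemma trans_neq_init t q : t \in T -> t q != s.
Proof. by case/mem_trans_semigroup => w w0 ->; apply: run_neq_init. Qed.

Lemma to_core_inj t t' q q' : t \in T -> t' \in T ->
  to_core (t q) = to_core (t' q') -> t q = t' q'.
Proof.
move=> tT t'T; case E: (to_core (t q)) => [p|] E'.
  by rewrite (to_core_Some E) (to_core_Some (esym E')).
by rewrite (to_core_None (trans_neq_init q tT) E) (to_core_None (trans_neq_init q' t'T) (esym E')).
Qed.

Lemma encode_inj : {in T &, injective encode}.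
Proof.
move=> t t' tT t'T [es /ffunP ef]; apply/ffunP => q.
have [->|qs] := eqVneq q s; first exact: to_core_inj.
have [->|qe] := eqVneq q e.
  have [w _ ->] := mem_trans_semigroup tT; have [w' _ ->] := mem_trans_semigroup t'T.
  by rewrite !run_sink.
have qc : (q != s) && (q != e) by rewrite qs.
by have := ef (exist _ q qc); rewrite !ffunE => /to_core_inj -> .
Qed.

Definition allowed (o : option core) : {set core} :=
  if o is Some p then [set r | colliding p r] else setT.

Lemma encode_colouring t : t \in T ->
  (encode t).2 \in colourings colliding (allowed (encode t).1) setT.
Proof.
move=> tT; rewrite inE; apply/andP; split.
  apply/forallP => a; apply/forallP => b; apply/implyP => gab; apply/implyP => /eqP.
  rewrite !ffunE => /(to_core_inj tT tT) E.
  by rewrite (colliding_unfocused tT gab E) to_core_sink.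
apply/forallP => a; rewrite ffunE; case E: (to_core _) => [c|] //.
rewrite inE andbT /=; case E': (to_core (t s)) => [p|]; rewrite inE //.
apply/orP; left; apply/existsP; exists t; rewrite tT (to_core_Some E') eqxx /=.
by apply/existsP; exists a; rewrite (to_core_Some E).
Qed.

(** The codes are sorted by the image of [s], which determines the set of allowed colours. *)
Lemma card_trans_semigroup_le : #|T| <=
  ncol colliding #|{: core}| 1 setT + \sum_p ncol colliding (deg colliding p) 1 setT.
Proof.
rewrite -(card_in_imset encode_inj) -sum1_card.
rewrite (partition_big fst predT) //=.
have opt (G : option core -> nat) : \sum_o G o = G None + \sum_p G (Some p).
  rewrite (bigD1 None) //=; congr (_ + _).
  rewrite (reindex_omap Some id) => [|[]//]; apply: eq_bigl => p; by rewrite eqxx.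
have H o : \sum_(z in encode @: T | z.1 == o) 1 <= ncol colliding #|allowed o| 1 setT.
  apply: leq_trans (card_colourings _ _ _); rewrite sum1dep_card.
  rewrite -(card_in_imset (f := snd)) => [|[o1 f1] [o2 f2]]; last first.
    by rewrite !inE => /andP[_ /eqP /= ->] /andP[_ /eqP /= ->] ->.
  apply: subset_leq_card; apply/subsetP => _ /imsetP[z + ->].
  rewrite inE => /andP[/imsetP[t tT ->] /eqP <-]; exact: encode_colouring.
rewrite opt; apply: leq_add; first by apply: leq_trans (H None) _; rewrite /= cardsT.
by apply: leq_sum => p _; apply: H.
Qed.

(** * Letters needed when no states collide *)

Definition total a := [forall q : core, delta a (val q) != e].
Definition permuting a := total a && injectiveb (fun q : core => delta a (val q)).

Lemma permuting_word u : all permuting u ->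
  exists2 h : core -> core, injective h & forall q, run (val q) u = val (h q).
Proof.
elim: u => [|a u IH] /=; first by exists id.
case/andP => /andP[/forallP ta /injectiveP ia] /IH[h hi hE].
have step (q : core) : (delta a (val q) != s) && (delta a (val q) != e).
  by rewrite ta andbT; apply: (@run_neq_init _ [:: a]).
exists (fun q => h (Sub (delta a (val q)) (step q))) => [q q' /hi /(congr1 val) /= /ia //|q].
exact: (hE (Sub (delta a (val q)) (step q))).
Qed.

(** [b] is the first letter of [w] that does not permute the core, and [h] is the action of the
    prefix before it. *)
Lemma first_nonpermuting w : all permuting w \/ exists b v, exists2 h : core -> core,
  injective h & ~~ permuting b /\ forall q : core, run (val q) w = run (delta b (val (h q))) v.
Proof.
elim/last_ind: w => [|w b IH]; first by left.
case: IH => [pw|[c [v [h hi [pc hE]]]]]; last first.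
  by right; exists c, (rcons v b), h => //; split=> // q; rewrite -!cats1 !run_cat hE.
case: (boolP (permuting b)) => pb; first by left; rewrite all_rcons pb.
right; have [h hi hE] := permuting_word pw; exists b, [::], h => //; split=> // q.
by rewrite -cats1 run_cat hE.
Qed.

Lemma fin_inj_surj (h : core -> core) q : injective h -> exists q', h q' = q.
Proof. by move=> hi; have [h' _ hK] := injF_bij hi; exists (h' q). Qed.

Section NoCollision.
Hypotheses (nocol : forall p r, colliding p r = false).
Hypothesis (full : (n - 1) ^ (n - 2) + n - 2 <= #|T|).

(** Without collisions every code has first component [None] or a blank second one. There are at
    most [(n - 1) ^ (n - 2) + n - 2] such pairs, so by [full] all of them occur, in particular
    [(None, f)]. *)
Lemma word_of (f : {ffun core -> option core}) : exists2 w, w <> [::] &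
  forall q : core, run (val q) w = if f q is Some p then val p else e.
Proof.
pose Z := [set z : option core * {ffun core -> option core} |
  (z.1 == None) || (z.2 == [ffun=> None])].
have sub : encode @: T \subset Z.
  apply/subsetP => _ /imsetP[t tT ->]; have := encode_colouring tT.
  rewrite !inE => /andP[_ /forallP h]; case: eqP => //= ne.
  apply/eqP/ffunP => q; have := h q; rewrite !ffunE; case: (to_core (t (val q))) => // c.
  by rewrite /encode /=; case: (to_core (t s)) ne => // p _; rewrite /= inE nocol.
have cZ : #|Z| <= #|T|.
  apply: leq_trans full.
  have -> : Z = setX [set None] setT :|: setX [set~ None] [set [ffun=> None]].
    by apply/setP => -[o f']; rewrite !inE /=; case: eqP.
  apply: leq_trans (leq_card_setU _ _) _.
  rewrite !cardsX cards1 cardsT card_ffun card_option cards1 cardsC1 card_option card_core /=.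
  have -> : (n - 2).+1 = n - 1 by clear -n7; lia.
  by rewrite mul1n muln1 addnBA // (leq_trans _ n7).
rewrite -(card_in_imset encode_inj) in cZ.
have /eqP EZ : encode @: T == Z by rewrite eqEcard sub.
have : (None, f) \in encode @: T by rewrite EZ inE eqxx.
case/imsetP => t tT [_ ->]; have [w w0 tw] := mem_trans_semigroup tT.
exists w => // q; rewrite ffunE -tw; case E: (to_core _) => [p|]; first exact: to_core_Some.
by apply: to_core_None E; apply: trans_neq_init.
Qed.

Lemma core_three : exists x y z : core, uniq [:: x; y; z].
Proof.
have : 3 <= size (enum {: core}) by rewrite -cardE card_core; lia.
have := enum_uniq {: core}; case: (enum _) => [|x [|y [|z l]]] //= + _.
rewrite !inE !negb_or => /andP[/and3P[xy xz _] /andP[/andP[yz _] _]].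
by exists x, y, z; rewrite /= !inE !negb_or xy xz yz.
Qed.

(** A letter that merges two core states or sends one to the sink cannot be undone later in the
    word. *)
Lemma word_of_perm (h : core -> core) : injective h -> exists w, [/\ w <> [::],
  all permuting w & forall q, run (val q) w = val (h q)].
Proof.
move=> hi; have [w w0 hw] := word_of [ffun q => Some (h q)].
have {}hw q : run (val q) w = val (h q) by rewrite hw ffunE.
exists w; split=> //; case: (first_nonpermuting w) => // -[b [v [k ki [/negP pb kE]]]].
case: pb; apply/andP; split.
  apply/forallP => q; have [q' <-] := fin_inj_surj q ki; apply/eqP => E.
  by have := core_neq_sink (h q'); rewrite -hw kE E run_sink eqxx.
apply/injectiveP => q q'; have [r <-] := fin_inj_surj q ki; have [r' <-] := fin_inj_surj q' ki.
by move=> E; congr k; apply: hi; apply: val_inj; rewrite -!hw !kE E.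
Qed.

(** Words over a single letter commute, while the transpositions [tperm x y] and [tperm y z] do
    not. *)
Lemma two_permuting : exists b c, [/\ b != c, permuting b & permuting c].
Proof.
have [x [y [z /=]]] := core_three; rewrite !inE negb_or andbT => /andP[/andP[xy xz] yz].
have [w1 [w10 p1 h1]] := word_of_perm (@perm_inj _ (tperm x y)).
have [w2 [w20 p2 h2]] := word_of_perm (@perm_inj _ (tperm y z)).
case: w1 w10 p1 h1 => // a w1 _ p1 h1; set w := a :: w1 in p1 h1.
have pa : permuting a by have /andP[] := p1.
case: (boolP (all (pred1 a) (w ++ w2))) => [|/allPn[b bw ba]]; last first.
  exists b, a; split=> //; move: bw; rewrite mem_cat => /orP[].
    exact: (allP p1).
  exact: (allP p2).
rewrite all_cat => /andP[/all_pred1P E1 /all_pred1P E2].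
have : run (val x) (w ++ w2) = run (val x) (w2 ++ w) by rewrite E1 E2 -!nseqD addnC.
rewrite !run_cat h1 !h2 h1 tpermL (tpermL y z) (@tpermD _ y z x) 1?eq_sym // tpermL.
by move/val_inj => zy; rewrite zy eqxx in yz.
Qed.

(** In a word that moves [x] to [y] and fixes the rest of the core, the first non-permuting letter
    sends no core state to the sink. *)
Lemma total_nonpermuting : exists c, total c && ~~ permuting c.
Proof.
have [x [y [z /=]]] := core_three; rewrite !inE negb_or andbT => /andP[/andP[xy _] _].
have [w w0 hw] := word_of [ffun q => Some (if q == x then y else q)].
have {}hw q : run (val q) w = val (if q == x then y else q) by rewrite hw ffunE.
case: (first_nonpermuting w) => [pw|[b [v [k ki [pb kE]]]]].
  have [h hi hE] := permuting_word pw.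
  have /hi E : h x = h y by apply: val_inj; rewrite -!hE !hw eqxx if_same.
  by rewrite E eqxx in xy.
exists b; rewrite pb andbT; apply/forallP => q; have [q' <-] := fin_inj_surj q ki.
apply/eqP => E; have := core_neq_sink (if q' == x then y else q').
by rewrite -hw kE E run_sink eqxx.
Qed.

(** The word sends only [x] to the sink and fixes the rest. Its first non-permuting letter, if
    total, would merge two core states, but the word merges none; and it spares the state coming
    from [y]. *)
Lemma nontotal_nonzero : exists d, ~~ total d && [exists q : core, delta d (val q) != e].
Proof.
have [x [y [z /=]]] := core_three; rewrite !inE negb_or andbT => /andP[/andP[xy _] _].
have [w w0 hw] := word_of [ffun q => if q == x then None else Some q].
have {}hw q : run (val q) w = if q == x then e else val q by rewrite hw ffunE; case: eqP.
have nx q : q != x -> run (val q) w != e by move=> qx; rewrite hw (negbTE qx) core_neq_sink.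
case: (first_nonpermuting w) => [pw|[b [v [k ki [pb kE]]]]].
  have [h hi hE] := permuting_word pw.
  by have := core_neq_sink (h x); rewrite -hE hw eqxx eqxx.
exists b; apply/andP; split; last first.
  apply/existsP; exists (k y); apply/eqP => E.
  by have := nx y; rewrite eq_sym xy kE E run_sink eqxx => /(_ isT).
apply: contra pb => tb; rewrite /permuting tb /=; apply/injectiveP => q q'.
have [r <-] := fin_inj_surj q ki; have [r' <-] := fin_inj_surj q' ki => E.
have : run (val r) w = run (val r') w by rewrite !kE E.
rewrite !hw; have [->|rx] := eqVneq r x; have [->|r'x] := eqVneq r' x => //.
- by move/esym/eqP; rewrite (negbTE (core_neq_sink _)).
- by move/eqP; rewrite (negbTE (core_neq_sink _)).
- by move/val_inj ->.
Qed.

(** The first letter of a word from [s] into the core cannot send [s] to the sink; sending any core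
    state into the core as well would create a collision. *)
Lemma initial_letter : exists a, [forall q : core, delta a (val q) == e].
Proof.
have [x _] := core_three.
have [[//|a w] _ /= xw] := reach_neq (core_neq_init x).
exists a; apply/forallP => q; apply/eqP.
have tT : induced delta [:: a] \in T by apply/trans_semigroupP; exists [:: a].
have := encode_colouring tT; rewrite inE => /andP[_ /forallP/(_ q)].
rewrite !ffunE /=; case E: (to_core (delta a (val q))) => [c|]; last first.
  by move=> _; apply: to_core_None E; apply: (@run_neq_init _ [:: a]).
rewrite /induced ffunE /=; case E': (to_core (delta a s)) => [p|]; first by rewrite inE nocol.
have E2 : delta a s = e by apply: to_core_None E'; apply: (@run_neq_init _ [:: a]).
by have /eqP[] := core_neq_sink x; rewrite -[val x]xw E2 run_sink.
Qed.

Lemma five_letters : 5 <= #|Sigma|.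
Proof.
have [b [b' [bb' pb pb']]] := two_permuting.
have [c /andP[tc pc]] := total_nonpermuting.
have [d /andP[td /existsP[q dq]]] := nontotal_nonzero.
have [a /forallP ha] := initial_letter.
have ta : ~~ total a by apply/negP => /forallP/(_ q); rewrite ha.
have tb : total b by case/andP: pb.
have tb' : total b' by case/andP: pb'.
(* [permuting] and [total] tell the letters apart, except [d] from [a], where [d] spares [q]. *)
have neq (P : pred Sigma) l l' : P l -> ~~ P l' -> l != l' by move=> h; apply: contraNneq => <-.
have u : uniq [:: b; b'; c; d; a].
  rewrite /= !inE !negb_or bb' !andbT /=.
  rewrite (neq permuting b c) // (neq permuting b' c) // (neq total b d) //.
  rewrite (neq total b a) // (neq total b' d) // (neq total b' a) //.
  rewrite (neq total c d) // (neq total c a) //=.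
  by apply: contraNneq dq => ->; apply: ha.
by have := max_card (mem [:: b; b'; c; d; a]); rewrite (card_uniqP u).
Qed.
End NoCollision.

Lemma card_trans_semigroup_lt : #|Sigma| < 5 -> #|T| < (n - 1) ^ (n - 2) + n - 2.
Proof.
move=> S5; have [a0|a0] := posnP (arcs colliding); last first.
  apply: leq_ltn_trans card_trans_semigroup_le _.
  have := colouring_bound colliding_sym colliding_irr _ a0.
  rewrite card_core => /(_ _); have -> : (n - 2).+1 = n - 1 by lia.
  rewrite -addnBA; last by lia.
  by apply; lia.
rewrite ltnNge; apply/negP => full.
have nocol p r : colliding p r = false.
  apply/negP => pr; have := a0; rewrite /arcs (bigD1 p) //= => /eqP.
  rewrite addn_eq0 cards_eq0 => /andP[/eqP/setP/(_ r)]; by rewrite !inE pr.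
by have := five_letters nocol full; rewrite leqNgt S5.
Qed.
End SuffixFree.

Theorem theorem2 (n : nat) (Sigma : finType)
    (delta : Sigma -> 'I_n -> 'I_n) (s : 'I_n) (F : {set 'I_n}) :
  7 <= n ->
  minimal delta s F ->
  suffix_free delta s F ->
  #|Sigma| < 5 ->
  exists T : {set {ffun 'I_n -> 'I_n}},
    (forall t, t \in T <-> in_trans_semigroup delta t) /\
    #|T| < (n - 1) ^ (n - 2) + n - 2.
Proof.
move=> n7 Hmin Hsf S5; exists (trans_semigroup delta); split.
  exact: trans_semigroupP.
exact: (card_trans_semigroup_lt n7 Hmin Hsf S5).
Qed.
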